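(* Let $h\in\mathbb R$. If $f:\mathbb R_+\to\mathbb R_+$ is smooth, with $f'(1)=0$, then there exists a $C^2$ strain energy function $W:\mathrm{GL}_+(3,\mathbb R)\to[0,\infty)$ which is objective, isotropic and homogeneous of degree $h$, such that $$W(F(\lambda,\omega))=(\lambda_1\lambda_2^2)^{h/3}f(\lambda_1/\lambda_2)\qquad\text{for all }\lambda=(\lambda_1,\lambda_2)\in\mathbb R_+^2,\ \omega\in S^2.$$
   Context: $\mathbb R_+=(0,\infty)$; $S^2$ is the unit sphere in $\mathbb R^3$; $\mathrm{GL}_+(3,\mathbb R)$ is the set of real $3\times3$ matrices with positive determinant. $W$ is objective if $W(UF)=W(F)$, and isotropic if $W(FU)=W(F)$, for all $F\in\mathrm{GL}_+(3,\mathbb R)$, $U\in\mathrm{SO}(3,\mathbb R)$; homogeneous of degree $h$ if $W(\sigma F)=\sigma^hW(F)$ for all $F\in\mathrm{GL}_+(3,\mathbb R)$, $\sigma>0$. For $\lambda\in\mathbb R_+^2$, $\omega\in S^2$: $F(\lambda,\omega)=\lambda_1P_1(\omega)+\lambda_2P_2(\omega)$ with $P_1(\omega)=\omega\otimes\omega$, $P_2(\omega)=I-\omega\otimes\omega$. *)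

(* Defs.v *)
From mathcomp Require Import all_boot all_order all_algebra.
From mathcomp Require Import all_classical all_reals all_analysis.

Set Implicit Arguments.
Unset Strict Implicit.
Unset Printing Implicit Defensive.

Import Order.TTheory GRing.Theory Num.Theory.
Import numFieldNormedType.Exports.

Local Open Scope classical_set_scope.
Local Open Scope ring_scope.

Definition GLplus (R : realType) (n : nat) : set 'M[R]_n :=
  [set F | 0 < \det F].

Definition SO (R : realType) (n : nat) : set 'M[R]_n :=
  [set U | U *m U^T = 1%:M /\ \det U = 1].

(* The Euclidean unit sphere; the library norm on matrices is the sup norm. *)
Definition sphere (R : realType) (n : nat) : set 'cV[R]_n :=
  [set w | \sum_(i < n) w i ord0 ^+ 2 = 1].

Definition P1 (R : realType) (w : 'cV[R]_3) : 'M[R]_3 := w *m w^T.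

Definition P2 (R : realType) (w : 'cV[R]_3) : 'M[R]_3 := 1%:M - w *m w^T.

Definition Fstrain (R : realType) (l1 l2 : R) (w : 'cV[R]_3) : 'M[R]_3 :=
  l1 *: P1 w + l2 *: P2 w.

(* Functions defined on an open set [D] are represented by total functions;
   everything below only involves their values on [D]. *)

(* [g] is of class C^k on the open set [D]. Since the domain is finite
   dimensional, it is enough to ask for the iterated directional derivatives
   (the values of the iterated Frechet derivatives) to be continuous. *)
Fixpoint class_C (R : realType) (m n : nat) (D : set 'M[R]_(m.+1, n.+1))
    (k : nat) (g : 'M[R]_(m.+1, n.+1) -> R^o) : Prop :=
  match k with
  | 0 => forall x, D x -> {for x, continuous g}
  | k'.+1 => (forall x, D x -> differentiable g x) /\
             (forall v, class_C D k' ('D_v g))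
  end.

Definition smooth_pos (R : realType) (f : R -> R) : Prop :=
  forall (k : nat) (x : R), 0 < x -> derivable (f^`(k))%classic x 1.

Definition objective (R : realType) (W : 'M[R]_3 -> R) : Prop :=
  forall F U, GLplus F -> SO U -> W (U *m F) = W F.

Definition isotropic (R : realType) (W : 'M[R]_3 -> R) : Prop :=
  forall F U, GLplus F -> SO U -> W (F *m U) = W F.

Definition homogeneous (R : realType) (h : R) (W : 'M[R]_3 -> R) : Prop :=
  forall (F : 'M[R]_3) (s : R), GLplus F -> 0 < s ->
    W (s *: F) = s `^ h * W F.

(* Main.v *)
Require Import Defs.
From mathcomp Require Import all_boot all_order all_algebra.
From mathcomp Require Import all_classical all_reals all_analysis.
From mathcomp Require Import ring zify.

(** The energy is sought as a function of the Cauchy-Green matrix [X = F^T F],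
    which makes it objective; using only conjugation invariants of [X] makes it
    isotropic.  For [F = Fstrain l1 l2 w] the eigenvalues of [X] are [l1^2], [l2^2],
    [l2^2], and the difficulty is at [l1 = l2]: the ratio [t = l1 / l2] is not a
    smooth function of [X] near the multiples of the identity.

    What is smooth is the square and the cube of a suitable coordinate.  The
    deviator of [X] has the eigenvalues [2/3 d], [-1/3 d], [-1/3 d] with
    [d = l1^2 - l2^2], so its second moment is a multiple of [d^2] and its
    determinant a multiple of [d^3].  Multiplying [d] by the trace of [X^-1] gives a
    coordinate of degree 0, namely [z = 2 t^2 - t^-2 - 1], which identifies the
    positive reals with the whole line and sends [t = 1] to 0.  The two smooth
    invariants [even_invariant] and [odd_invariant] extend [z^2] and [z^3] to all
    matrices of positive determinant ([even_invariant_Fstrain],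
    [odd_invariant_Fstrain]).

    Let [g z = ln (f t)].  It is smooth on the line and [g' 0 = 0], so its Taylor
    expansion has no term in [z], and [g z = E (z^2) + z^3 * O (z^2)] with [E]
    and [O] of class C^2 on the whole line ([even_odd_decomposition]).  The Taylor
    polynomial is split by the parity of the exponents; the remainder vanishes to
    high order at 0, hence stays C^2 after substituting [sqrt x] for [z],
    dividing by a power of [sqrt x] and extending by zero to the negative reals
    ([is_Ck_sqrt_quotient]).

    The energy is then [det F ^ (h/3) * exp (E u + v * O u)], with [u] and [v] the
    two invariants of [X].  The exponential keeps it positive away from the matrices
    [Fstrain l1 l2 w], where [E u + v * O u] is not controlled. *)

Set Implicit Arguments.
Unset Strict Implicit.
Unset Printing Implicit Defensive.

Import Order.TTheory GRing.Theory Num.Theory.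
Import numFieldNormedType.Exports.

Local Open Scope classical_set_scope.
Local Open Scope ring_scope.

(** * Functions of class C^k on a set *)

Section Ck.
Context {R : realType} {V : normedModType R}.

(** The derivative is a witness [dg], constrained on [D] only, rather than the
    directional derivative of [g] itself: sums, products and composites then
    give their derivatives by formula, and the behaviour of [g] outside [D] never
    enters.  A single predicate covers profiles on the line and functions of a
    matrix, which is what composition needs. *)
Fixpoint is_Ck (D : set V) (k : nat) (g : V -> R) : Prop :=
  match k with
  | 0 => forall x, D x -> {for x, continuous g}
  | k'.+1 => exists dg : V -> V -> R,
      (forall x, D x -> is_diff x g (dg^~ x)) /\ forall v, is_Ck D k' (dg v)
  end.

End Ck.

Section Calculus.
Context {R : realType}.
Section OneSpace.
Context {V : normedModType R}.
Implicit Types (D : set V) (g : V -> R) (k : nat).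

Lemma is_CkW D k g : is_Ck D k.+1 g -> is_Ck D k g.
Proof.
elim: k g => [|k IH] g [dg [ddg dgC]].
  by move=> x Dx; apply: differentiable_continuous; have := ddg x Dx; case.
by exists dg; split=> // v; exact: IH.
Qed.

Lemma is_Ck_subset D E k g : D `<=` E -> is_Ck E k g -> is_Ck D k g.
Proof.
move=> DE; elim: k g => [|k IH] g; first by move=> gE x /DE /gE.
move=> [dg [ddg dgC]]; exists dg; split=> [x /DE|v].
  exact: ddg.
exact: IH (dgC v).
Qed.

(** Writing [g = f + (g - f)] reduces the claim to a function vanishing near [x],
    whose differential is zero. *)
Lemma is_diff_near_eq (x : V) (f g df : V -> R) :
  (\near x, f x = g x) -> is_diff x f df -> is_diff x g df.
Proof.
move=> fg fdf.
have h0 : \near x, (g - f) x = 0.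
  by apply: filterS fg => y fgy; rewrite !fctE/= fgy subrr.
have hx : continuous (\0 : V -> R) /\
    (g - f) \o shift x = cst ((g - f) x) + \0 +o_ 0 id.
  split; first exact: cst_continuous.
  apply/eqaddoP => _/posnumP[e].
  have h0' := nbhs_singleton h0.
  move: h0; rewrite (near_shift 0 x) subr0; apply: filterS => y /= h0y.
  rewrite !fctE/= addr0; move: h0y h0'; rewrite !fctE => -> ->.
  by rewrite subrr normr0 mulr_ge0.
have hd : 'd (g - f) x = \0 :> (V -> R).
  by apply: diff_unique; case: hx.
have hdf : differentiable (g - f) x.
  by apply/diff_locallyP; rewrite hd.
have -> : g = f + (g - f) by rewrite addrC subrK.
apply: is_diff_eq.
  apply: is_diffD. by apply: differentiableP.
by rewrite hd addr0.
Qed.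

Lemma is_Ck_eq D k f g : open D -> (forall x, D x -> f x = g x) ->
  is_Ck D k f -> is_Ck D k g.
Proof.
move=> oD fg; have nfg x : D x -> \near x, f x = g x.
  by move=> Dx; apply: filterS fg _; exact: open_nbhs_nbhs.
case: k => [fC x Dx|k [dg [ddg dgC]]].
  have := fC x Dx; rewrite /prop_for /continuous_at (fg _ Dx) => /(_ _) h.
  by apply: cvg_trans h; apply: near_eq_cvg; exact: nfg.
exists dg; split=> // x Dx; apply: is_diff_near_eq (ddg x Dx); exact: nfg.
Qed.

Lemma is_Ck_cst D k (a : R) : is_Ck D k (cst a).
Proof.
elim: k a => [|k IH] a; first by move=> x _; exact: cst_continuous.
exists (fun _ => cst 0); split=> [x _|v]; [exact: is_diff_cst|exact: IH].
Qed.

Lemma is_CkD D k f g : is_Ck D k f -> is_Ck D k g -> is_Ck D k (f + g).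
Proof.
elim: k f g => [|k IH] f g; last first.
  move=> [df [ddf dfC]] [dg [ddg dgC]].
  exists (fun v => df v + dg v); split=> [x Dx|v]; last exact: IH (dfC v) (dgC v).
  have := ddf x Dx; have := ddg x Dx => ? ?.
  exact: is_diffD.
move=> fC gC x Dx.
by apply: continuousD; [exact: (fC x Dx)|exact: (gC x Dx)].
Qed.

Lemma is_CkM D k f g : is_Ck D k f -> is_Ck D k g -> is_Ck D k (f * g).
Proof.
elim: k f g => [|k IH] f g; first by
  move=> fC gC x Dx; apply: continuousM; [exact: (fC x Dx)|exact: (gC x Dx)].
move=> fC gC; have [fW gW] := (is_CkW fC, is_CkW gC).
have [df [ddf dfC]] := fC; have [dg [ddg dgC]] := gC.
exists (fun v => f * dg v + g * df v); split=> [x Dx|v]; last first.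
  by apply: is_CkD; [exact: IH fW (dgC v)|exact: IH gW (dfC v)].
have := ddf x Dx; have := ddg x Dx => ? ?.
exact: is_diffM.
Qed.

Lemma is_CkZ D k (a : R) g : is_Ck D k g -> is_Ck D k (fun x => a * g x).
Proof. by move=> gC; exact: is_CkM (is_Ck_cst D k a) gC. Qed.

Lemma is_Ck_sum D k (I : Type) (r : seq I) (P : pred I) (F : I -> V -> R) :
  (forall i, is_Ck D k (F i)) -> is_Ck D k (fun x => \sum_(i <- r | P i) F i x).
Proof.
move=> FC; rewrite -fct_sumE.
by apply: big_ind => [||i _//]; [exact: is_Ck_cst|exact: is_CkD].
Qed.

Lemma is_Ck_prod D k (I : Type) (r : seq I) (P : pred I) (F : I -> V -> R) :
  (forall i, is_Ck D k (F i)) -> is_Ck D k (fun x => \prod_(i <- r | P i) F i x).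
Proof.
move=> FC.
have -> : (fun x => \prod_(i <- r | P i) F i x) =
    \big[ *%R/cst 1]_(i <- r | P i) F i.
  by apply/funext => x; elim/big_rec2 : _ => // i y f _ ->.
by apply: big_ind => [||i _//]; [exact: is_Ck_cst|exact: is_CkM].
Qed.

Lemma is_Ck_comp D (E : set R) k (f : R -> R) g :
  (forall x, D x -> E (g x)) -> is_Ck E k f -> is_Ck D k g ->
  is_Ck D k (f \o g).
Proof.
move=> gE; elim: k f g gE => [|k IH] f g gE.
  move=> fC gC x Dx; apply: continuous_comp; first exact: (gC x Dx).
  exact: (fC _ (gE x Dx)).
move=> [df [ddf dfC]] gC; have gW := is_CkW gC.
have [dg [ddg dgC]] := gC.
exists (fun v => dg v * (df 1 \o g)); split=> [x Dx|v]; last first.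
  by apply: is_CkM (dgC v) _; exact: IH (dfC 1) gW.
have dgx := ddg x Dx; have dfx := ddf _ (gE _ Dx).
apply: is_diff_eq; apply/funext => v; rewrite !fctE/=.
have dfE u : df u (g x) = 'd f (g x) u by rewrite diff_val.
by rewrite !dfE -[in LHS](mulr1 (dg v x)) [LHS]linearZ.
Qed.

End OneSpace.


Lemma is_Ck_coord m n (D : set 'M[R]_(m.+1, n.+1)) k i j :
  is_Ck D k (fun M => M i j).
Proof.
case: k => [x _|k]; first exact: coord_continuous.
exists (fun v : 'M[R]_(m.+1, n.+1) => cst (v i j)).
split=> [x _|v]; last exact: is_Ck_cst.
split; first exact: differentiable_coord.
have @f : {linear 'M[R]_(m.+1, n.+1) -> R}.
  by exists (fun N : 'M[R]_(_, _) => N i j); do 2![eexists]; do ?[constructor];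
     rewrite ?mxE// => ? *; rewrite ?mxE//; move=> ?; rewrite !mxE.
by rewrite (_ : (fun _ => _) = f) // diff_lin //; exact: coord_continuous.
Qed.

(** On an open set the directional derivative along [v] agrees with the witness
    [dg v], and [is_Ck] only sees values on that set. *)
Lemma is_Ck_class_C m n (D : set 'M[R]_(m.+1, n.+1)) k
    (g : 'M[R]_(m.+1, n.+1) -> R) :
  open D -> is_Ck D k g -> class_C D k g.
Proof.
move=> oD; elim: k g => [//|k IH] g [dg [ddg dgC]] /=; split=> [x /ddg[]//|v].
apply: IH; apply: is_Ck_eq (dgC v) => // x Dx.
have [dx dE] := ddg x Dx.
by rewrite deriveE // dE.
Qed.

Lemma is_Ck_derive (D : set R) k (f f' : R -> R) :
  (forall x, D x -> is_derive x 1 f (f' x)) -> is_Ck D k f' -> is_Ck D k.+1 f.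
Proof.
move=> df f'C; exists (fun v x => v * f' x); split=> [x Dx|v]; last exact: is_CkZ.
have [dx dE] := df x Dx.
have dx' : differentiable f x by apply/derivable1_diffP.
by split=> //; rewrite diff1E // derive1E dE.
Qed.

Lemma is_Ck_ex_derive (D : set R) k (f : R -> R) : is_Ck D k.+1 f ->
  exists2 f' : R -> R, (forall x, D x -> is_derive x 1 f (f' x)) & is_Ck D k f'.
Proof.
move=> [df [ddf dfC]]; exists (df 1); last exact: dfC 1.
move=> x Dx; have [dx dE] := ddf x Dx.
by split; [apply: diff_derivable|rewrite deriveE // dE].
Qed.

Lemma is_Ck_expR k D : is_Ck D k (@expR R).
Proof.
elim: k => [x _|k IH]; first exact: continuous_expR.
by apply: is_Ck_derive IH => x _; exact: is_derive_expR.
Qed.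

Lemma is_Ck_id k (D : set R) : is_Ck D k (id : R -> R).
Proof.
case: k => [x _|k]; first exact: cvg_id.
by apply: is_Ck_derive (is_Ck_cst D k 1) => x _; exact: is_derive_id.
Qed.

Lemma is_Ck_inv k : is_Ck [set x : R | x != 0] k (GRing.inv : R -> R).
Proof.
elim: k => [x x0|k IH]; first exact: inv_continuous.
apply: (@is_Ck_derive _ _ _ (fun x => -1 * (x^-1 * x^-1))).
  move=> x x0; have dx := differentiable_Rinv x0.
  split; first exact/derivable1_diffP.
  by rewrite deriveE // diff_Rinv // [LHS]mulr1 expr2 invfM mulN1r.
by apply: is_CkZ; exact: is_CkM.
Qed.

Lemma is_Ck_ln k : is_Ck [set x : R | 0 < x] k (@ln R).
Proof.
case: k => [x x0|k]; first exact: continuous_ln.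
apply: (@is_Ck_derive _ _ _ GRing.inv).
by apply: is_Ck_subset _ (is_Ck_inv k) => x /= x0; rewrite gt_eqF.
Qed.

Lemma is_Ck_poly k (D : set R) (p : {poly R}) : is_Ck D k (horner p).
Proof.
elim: k p => [p x _|k IH p]; first exact: continuous_horner.
by apply: is_Ck_derive (IH p^`()) => x _; exact: is_derive_poly.
Qed.

Lemma is_Ck_smooth_pos (f : R -> R) k :
  smooth_pos f -> is_Ck [set x : R | 0 < x] k f.
Proof.
move=> fs; rewrite -[f]/(f^`(0))%classic; elim: k 0%N => [i x x0|k IH i].
  by apply: differentiable_continuous; apply/derivable1_diffP; exact: fs.
apply: is_Ck_derive (IH i.+1) => x x0.
by split; [exact: fs|rewrite derive1nS derive1E].
Qed.

Lemma is_CkV (V : normedModType R) (D : set V) k (g : V -> R) :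
  (forall x, D x -> g x != 0) -> is_Ck D k g -> is_Ck D k (fun x => (g x)^-1).
Proof. by move=> g0; exact: is_Ck_comp g0 (is_Ck_inv k). Qed.

Lemma is_Ck_powR (V : normedModType R) (D : set V) k (g : V -> R) (a : R) :
  open D -> (forall x, D x -> 0 < g x) -> is_Ck D k g ->
  is_Ck D k (fun x => g x `^ a).
Proof.
move=> oD g0 gC.
apply: (@is_Ck_eq _ _ _ (expR \o (fun x => a * ln (g x)))) => //.
  by move=> x /g0 gx0; rewrite /= /powR gt_eqF.
apply: (@is_Ck_comp _ _ setT) => //; first exact: is_Ck_expR.
by apply: is_CkZ; exact: is_Ck_comp g0 (is_Ck_ln k) gC.
Qed.

End Calculus.

(** * Taylor remainders *)

Section Flat.
Context {R : realType}.

(** [r] is of class C^n and its derivatives of order less than [n] vanish at 0. *)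
Fixpoint flat (n : nat) (r : R -> R) : Prop :=
  match n with
  | 0 => continuous r
  | n'.+1 => r 0 = 0 /\
      exists2 r' : R -> R, (forall x : R, is_derive x 1 r (r' x)) & flat n' r'
  end.

Lemma is_derive_continuous (f : R -> R) (x d : R) :
  is_derive x 1 f d -> {for x, continuous f}.
Proof. by move=> df; exact/differentiable_continuous/derivable1_diffP. Qed.

Lemma flatW n r : flat n.+1 r -> flat n r.
Proof.
elim: n r => [|n IH] r [r0 [r' dr r'n]]; last first.
  by split=> //; exists r' => //; exact: IH.
by move=> x; exact: is_derive_continuous (dr x).
Qed.

Lemma flat_le m n r : (m <= n)%N -> flat n r -> flat m r.
Proof.
elim: n => [|n IH]; first by rewrite leqn0 => /eqP ->.
by rewrite leq_eqVlt => /predU1P[->//|/IH {}IH /flatW].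
Qed.

(** Integrate the bound on the derivative: the mean value theorem on the segment
    from 0 to [z] gains one power of [z] at each step. *)
Lemma flat_bound n r : flat n r ->
  exists2 C : R, 0 <= C & \forall z \near 0, `|r z| <= C * `|z| ^+ n.
Proof.
elim: n r => [|n IH] r /=.
  move=> rc; exists (`|r 0| + 1) => //.
  have /(cvgr_norm_le _ (rc 0)) : `|r 0| < `|r 0| + 1 by rewrite ltrDl.
  by apply: filterS => z; rewrite expr0 mulr1.
move=> [r0 [r' dr r'n]]; have [C C0 rC] := IH _ r'n; exists C => //.
have [e /= e0 be] := rC; exists e => // z /=; rewrite sub0r normrN => ze.
(* Running along the segment treats both signs of z at once. *)
pose g t := r (t * z).
have dg (t : R) : is_derive t 1 g (r' (t * z) * z).
  have := dr (t * z) => ?.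
  apply: (@is_derive_eq _ _ _ (r \o (fun t => t * z))).
  by rewrite /= scaler0 add0r scaler1 mulrC.
have [|t t01] := @MVT_segment R g (fun t => r' (t * z) * z) 0 1 ler01.
  by apply: continuous_subspaceT => t; exact: is_derive_continuous (dg t).
rewrite /g mul1r mul0r r0 !subr0 mulr1 => ->.
have tz : `|t * z| <= `|z|.
  move: t01; rewrite in_itv/= => /andP[t0 t1].
  by rewrite normrM ger0_norm // ler_piMl.
rewrite normrM exprSr mulrA ler_wpM2r //.
apply: (le_trans (be (t * z) _)).
  by rewrite /= sub0r normrN (le_lt_trans tz).
by rewrite ler_wpM2l // lerXn2r ?nnegrE.
Qed.

(** The constant coefficient is [p`_0 / 0], which is 0. *)
Definition primitive_poly (p : {poly R}) : {poly R} :=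
  \poly_(i < (size p).+1) (p`_i.-1 / i%:R).

Lemma deriv_primitive_poly p : (primitive_poly p)^`() = p.
Proof.
apply/polyP => i; rewrite coef_deriv coef_poly ltnS /=.
case: ltnP => [_|ip]; last by rewrite mul0rn nth_default.
by rewrite -[LHS]mulr_natr divfK ?pnatr_eq0.
Qed.

Lemma horner0_primitive_poly p : (primitive_poly p).[0] = 0.
Proof. by rewrite horner_coef0 coef_poly /= invr0 mulr0. Qed.

(** Taylor's theorem: a primitive of the Taylor polynomial of the derivative,
    with the right constant term, is the Taylor polynomial of the function. *)
Lemma taylor_flat n (g : R -> R) : is_Ck setT n g ->
  exists p : {poly R}, flat n (g - horner p).
Proof.
elim: n g => [g gC|n IH g /is_Ck_ex_derive[g' dg /IH[p gp]]].
  exists 0 => x; apply: continuousB; [exact: gC|exact: continuous_horner].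
exists (primitive_poly p + (g 0)%:P); split.
  by rewrite !fctE !hornerE horner0_primitive_poly add0r subrr.
exists (g' - horner p) => // x.
have dgx := dg x I.
apply: is_derive_eq.
by rewrite derivD derivC addr0 deriv_primitive_poly.
Qed.

End Flat.

(** * Substituting a square root *)

Section SqrtQuotient.
Context {R : realType}.

(** With [e] equal to 1 or -1, half sums and half differences of these functions
    are the even and odd parts of [r] read in the variable [x = z ^ 2].  The
    exponent [m] is a parameter because differentiation raises it. *)
Definition sqrt_quotient (r : R -> R) (e : R) (m : nat) (x : R) : R :=
  if 0 < x then r (e * Num.sqrt x) / Num.sqrt x ^+ m else 0.

Lemma cvg_mul_sqrt0 (C : R) : (fun x => C * Num.sqrt x) @ (0 : R) --> (0 : R).
Proof.
rewrite -[X in _ --> X](mulr0 C) -[X in _ --> C * X](@sqrtr0 R).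
by apply: cvgM; [exact: cvg_cst|exact: sqrt_continuous].
Qed.

Lemma sqrt_quotient_bound r e m n : `|e| = 1 -> (m <= n)%N -> flat n r ->
  exists2 C : R, 0 <= C &
    \forall x \near (0 : R), `|sqrt_quotient r e m x| <= C * Num.sqrt x ^+ (n - m).
Proof.
move=> e1 mn /flat_bound[C C0 rC]; exists C => //.
have cv := cvg_mul_sqrt0 e.
have : \forall x \near (0 : R),
    `|r (e * Num.sqrt x)| <= C * `|e * Num.sqrt x| ^+ n by exact: cv _ rC.
apply: filterS => x /=; rewrite /sqrt_quotient normrM e1 mul1r.
have [x0 rx|_ _] := ltP 0 x; last first.
  by rewrite normr0 mulr_ge0 // exprn_ge0 ?sqrtr_ge0.
have s0 : 0 < Num.sqrt x by rewrite sqrtr_gt0.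
rewrite normrM normfV normrX ger0_norm in rx *; last exact: ltW.
by rewrite ler_pdivrMr ?exprn_gt0 // -mulrA -exprD subnK.
Qed.

(** The family of functions [sqrt_quotient] is stable under differentiation. *)
Lemma is_derive_sqrt_quotient_gt0 (r r' : R -> R) (e : R) m (x : R) :
  (forall z : R, is_derive z 1 r (r' z)) -> 0 < x ->
  is_derive x 1 (sqrt_quotient r e m)
   (e / 2 * sqrt_quotient r' e m.+1 x - m%:R / 2 * sqrt_quotient r e m.+2 x).
Proof.
move=> dr x0; have s0 : 0 < Num.sqrt x by rewrite sqrtr_gt0.
have sN0 := lt0r_neq0 s0.
apply: (@near_eq_is_derive _ _ _
  (((r \o ( *%R e)) * ((GRing.inv : R -> R) ^+ m)) \o Num.sqrt)).
  near=> y; rewrite /sqrt_quotient /= !fctE /= exprVn ifT //.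
  by near: y; exact: lt_nbhsr.
have ds : is_derive x 1 Num.sqrt (2 * Num.sqrt x)^-1 by exact: is_derive1_sqrt.
have dres : is_derive (Num.sqrt x) 1 (r \o ( *%R e)) (r' (e * Num.sqrt x) * e).
  have := dr (e * Num.sqrt x) => ?.
  apply: is_derive1_comp.
  by apply: is_derive_eq; rewrite [LHS]mulr1.
have dV : is_derive (Num.sqrt x) 1 (GRing.inv : R -> R) (- Num.sqrt x ^- 2).
  have dx := differentiable_Rinv sN0; split; first exact/derivable1_diffP.
  by rewrite deriveE // diff_Rinv // [LHS]mulr1.
have dX := @is_deriveX _ _ _ m _ _ _ dV.
have dM := is_deriveM dres dX.
have dC := is_derive1_comp dM ds.
apply: is_derive_eq.
rewrite /sqrt_quotient x0 /= !fctE /GRing.scale/=.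
move: (r _) (r' _) {dX dM dC} => a b; case: m => [|m] /=; first by field.
rewrite !exprVn !exprS; have smN0 := expf_neq0 m sN0; field.
by rewrite sN0 smN0.
Unshelve. all: by end_near. Qed.

Lemma is_derive_sqrt_quotient_neq0 (r r' : R -> R) (e : R) m (x : R) :
  (forall z : R, is_derive z 1 r (r' z)) -> x != 0 ->
  is_derive x 1 (sqrt_quotient r e m)
   (e / 2 * sqrt_quotient r' e m.+1 x - m%:R / 2 * sqrt_quotient r e m.+2 x).
Proof.
move=> dr; rewrite neq_lt => /orP[x0|]; last exact: is_derive_sqrt_quotient_gt0.
have q0 s n : sqrt_quotient s e n x = 0.
  by rewrite /sqrt_quotient ltNge (ltW x0).
rewrite !q0 !mulr0 subr0; apply: (@near_eq_is_derive _ _ _ (cst 0)).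
near=> y; rewrite /sqrt_quotient ifF //; apply/negbTE; rewrite -leNgt ltW //.
by near: y; exact: lt_nbhsl.
Unshelve. all: by end_near. Qed.

Lemma sqrt_quotient0 r e m : sqrt_quotient r e m 0 = 0.
Proof. by rewrite /sqrt_quotient ltxx. Qed.

(** At the origin the difference quotient is at most a multiple of [sqrt h], since
    the function is bounded by a multiple of [(sqrt h) ^ 3]. *)
Lemma is_derive_sqrt_quotient (r r' : R -> R) (e : R) m (x : R) :
  `|e| = 1 -> flat (m + 3) r ->
  (forall z : R, is_derive z 1 r (r' z)) ->
  is_derive x 1 (sqrt_quotient r e m)
   (e / 2 * sqrt_quotient r' e m.+1 x - m%:R / 2 * sqrt_quotient r e m.+2 x).
Proof.
move=> e1 fr dr; have [->|x0] := eqVneq x 0; last first.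
  exact: is_derive_sqrt_quotient_neq0.
rewrite !sqrt_quotient0 !mulr0 subr0.
have [C C0 bC] := sqrt_quotient_bound e1 (leq_addr 3 m) fr.
suff d0 : (fun h : R => h^-1 *: ((sqrt_quotient r e m \o shift 0) (h *: 1) -
    sqrt_quotient r e m 0)) @ 0^' --> (0 : R).
  by split; [apply/cvg_ex; exists 0|exact/cvg_lim].
have cC := cvg_mul_sqrt0 C.
have cC' : (fun x => C * Num.sqrt x) @ (0 : R)^' --> (0 : R).
  by apply: cvg_trans cC; apply: cvg_app; exact: cvg_within.
apply: (@squeeze_cvgr _ _ _ _ (fun h => - (C * Num.sqrt h))
  (fun h => C * Num.sqrt h)).
- move: bC; rewrite addKn => bC.
  near=> h; rewrite -ler_norml /= addr0 sqrt_quotient0 subr0.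
  rewrite [h *: 1]mulr1 [_ *: _]mulrC.
  have : `|sqrt_quotient r e m h| <= C * Num.sqrt h ^+ 3.
    by near: h; exact: nbhs_dnbhs bC.
  rewrite /sqrt_quotient; case: ltP => [h0 bh|h0 _]; last first.
    by rewrite mul0r normr0 mulr_ge0 ?sqrtr_ge0.
  rewrite normrM normfV (gtr0_norm h0) ler_pdivrMr // -mulrA.
  suff <- : Num.sqrt h ^+ 3 = Num.sqrt h * h by [].
  by rewrite exprS sqr_sqrtr // ltW.
- by rewrite -[X in _ --> X]oppr0; exact: cvgN cC'.
- by [].
Unshelve. all: by end_near. Qed.

(** Each derivative in [x] costs two orders of vanishing in [z = sqrt x]: either
    [m] grows by two, or it grows by one while differentiating [r] lowers [n] by
    one.  The strict inequality leaves one order for continuity at the origin. *)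
Lemma is_Ck_sqrt_quotient k (r : R -> R) (e : R) m n : `|e| = 1 ->
  (m + 2 * k < n)%N -> flat n r -> is_Ck setT k (sqrt_quotient r e m).
Proof.
move=> e1; elim: k r m n => [|k IH] r m n mn fr.
  move=> x _; have [->|x0] := eqVneq x 0; last first.
    have [r0 [r' dr _]] : flat 1 r by apply: flat_le fr; lia.
    exact: is_derive_continuous (is_derive_sqrt_quotient_neq0 e m dr x0).
  have fr1 : flat (m + 1) r by apply: flat_le fr; lia.
  have [C C0] := sqrt_quotient_bound e1 (leq_addr 1 m) fr1; rewrite addKn => bC.
  rewrite /prop_for /continuous_at sqrt_quotient0.
  apply: (@squeeze_cvgr _ _ _ _ (fun h => - (C * Num.sqrt h))
    (fun h => C * Num.sqrt h)).
  - by apply: filterS bC => y; rewrite -ler_norml expr1.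
  - by rewrite -[X in _ --> X]oppr0; exact: cvgN (cvg_mul_sqrt0 C).
  - exact: cvg_mul_sqrt0.
case: n => // n in mn fr *; have [r0 [r' dr fr']] := fr.
apply: (@is_Ck_derive _ _ _ _ (fun x => e / 2 * sqrt_quotient r' e m.+1 x
    + (- (m%:R / 2)) * sqrt_quotient r e m.+2 x)).
  move=> x _; rewrite mulNr; apply: is_derive_sqrt_quotient => //.
  by apply: flat_le fr; lia.
apply: is_CkD; apply: is_CkZ; first by apply: IH fr'; lia.
by apply: IH fr; lia.
Qed.

End SqrtQuotient.

(** * Even and odd parts of the logarithmic profile *)

Section EvenOdd.
Context {R : realType}.

(** The even and odd parts of [r], the latter divided by [z ^ 3], as functions of
    [z ^ 2]; they are C^k because [r] vanishes at 0 to the order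
    [3 + 2 * k + 1] that the divisor [z ^ 3] and [k] derivatives require. *)
Lemma flat_even_odd k (r : R -> R) : flat (2 * k + 4) r ->
  exists E O : R -> R, [/\ is_Ck setT k E, is_Ck setT k O &
    forall z, r z = E (z ^+ 2) + z ^+ 3 * O (z ^+ 2)].
Proof.
move=> fr; pose q := sqrt_quotient r.
have qC e m : `|e| = 1 -> (m <= 3)%N -> is_Ck setT k (q e m).
  by move=> e1 m3; apply: is_Ck_sqrt_quotient e1 _ fr; lia.
have n1 : `|1 : R| = 1 by rewrite normr1.
have nN1 : `|-1 : R| = 1 by rewrite normrN1.
exists (fun x => 2^-1 * (q 1 0%N x + q (-1) 0%N x)).
exists (fun x => 2^-1 * (q 1 3%N x + -1 * q (-1) 3%N x)); split.
- by apply: is_CkZ; apply: is_CkD; apply: qC.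
- by apply: is_CkZ; apply: is_CkD; [|apply: is_CkZ]; apply: qC.
move=> z; rewrite /q /sqrt_quotient sqrtr_sqr exprn_even_gt0 //= !mul1r !mulN1r.
rewrite expr0 !divr1.
have [->|z0 /=] := eqVneq z 0.
  have [-> _] : flat 1 r by apply: flat_le fr; lia.
  by rewrite /= expr0n /=; ring.
have [zp|zn|z00] := ltgtP 0 z; last by rewrite z00 eqxx in z0.
  by rewrite gtr0_norm //; field.
by rewrite ltr0_norm // opprK; field.
Qed.

(** A finite-order form of Whitney's theorem on even functions.  The Taylor
    polynomial splits algebraically and the remainder is flat.  Since the
    derivative at 0 vanishes, the odd part of the polynomial starts at [z ^ 3]. *)
Lemma even_odd_decomposition k (g : R -> R) :
  is_Ck setT (2 * k + 4) g -> is_derive (0 : R) 1 g 0 ->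
  exists E O : R -> R, [/\ is_Ck setT k E, is_Ck setT k O &
    forall z, g z = E (z ^+ 2) + z ^+ 3 * O (z ^+ 2)].
Proof.
move=> gC g'0; have [p fr] := taylor_flat gC.
have [Er [Or [ErC OrC rE]]] := flat_even_odd fr.
have p1 : p`_1 = 0.
  have [_ [r' dr [r'0 _]]] : flat 2 (g - horner p) by apply: flat_le fr; lia.
  have dr0 := dr 0; rewrite r'0 in dr0.
  have := @derive_val _ _ _ _ _ _ _ dr0.
  rewrite deriveB // !derive_val sub0r => /eqP.
  by rewrite oppr_eq0 horner_coef0 coef_deriv mulr1n => /eqP.
have /factor_theorem[q qE] : root (odd_poly p) 0.
  by rewrite /root horner_coef0 coef_odd_poly p1.
exists (horner (even_poly p) + Er), (horner q + Or); split.
- exact: is_CkD (is_Ck_poly _ _ _) ErC.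
- exact: is_CkD (is_Ck_poly _ _ _) OrC.
move=> z; have -> : g z = p.[z] + (g - horner p) z by rewrite !fctE; ring.
have -> : p.[z] = (even_poly p).[z ^+ 2] + q.[z ^+ 2] * z ^+ 2 * z.
  rewrite -{1}(poly_even_odd p) qE hornerD hornerM !horner_comp hornerXn hornerX.
  by rewrite hornerM hornerXsubC subr0.
rewrite rE !fctE; ring.
Qed.

Lemma is_Ck_sqrt (V : normedModType R) (D : set V) k (g : V -> R) :
  open D -> (forall x, D x -> 0 < g x) -> is_Ck D k g ->
  is_Ck D k (fun x => Num.sqrt (g x)).
Proof.
move=> oD g0 gC; apply: is_Ck_eq (is_Ck_powR 2^-1 oD g0 gC) => // x Dx.
by rewrite powR12_sqrt // ltW ?g0.
Qed.

(** The map [t |-> 2 t^2 - t^-2 - 1] is an increasing bijection from the positive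
    reals onto the line; solving a quadratic equation in [t^2] inverts it. *)
Definition stretch_ratio (z : R) : R :=
  Num.sqrt ((1 + z + Num.sqrt ((1 + z) ^+ 2 + 8)) / 4).

Lemma stretch_ratio_radicand_gt0 (z : R) :
  0 < (1 + z + Num.sqrt ((1 + z) ^+ 2 + 8)) / 4.
Proof.
rewrite divr_gt0 // -ltrBlDl sub0r.
apply: le_lt_trans (ler_norm _) _; rewrite normrN -sqrtr_sqr.
by rewrite ltr_sqrt ?ltrDl // ltr_wpDl // sqr_ge0.
Qed.

Lemma stretch_ratio_gt0 z : 0 < stretch_ratio z.
Proof. by rewrite sqrtr_gt0 stretch_ratio_radicand_gt0. Qed.

Lemma is_Ck_stretch_ratio k : is_Ck setT k stretch_ratio.
Proof.
apply: is_Ck_sqrt => [|x _|]; [exact: openT|exact: stretch_ratio_radicand_gt0|].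
have lC : is_Ck setT k (fun z : R => 1 + z).
  exact: is_CkD (is_Ck_cst _ _ _) (is_Ck_id _ _).
apply: is_CkM _ (is_Ck_cst _ _ _); apply: (is_CkD lC).
apply: is_Ck_sqrt => [|x _|]; first exact: openT.
  by rewrite ltr_wpDl // sqr_ge0.
apply: is_CkD _ (is_Ck_cst _ _ _).
exact: (is_CkM lC lC).
Qed.

Lemma stretch_ratioE (t : R) : 0 < t ->
  stretch_ratio (2 * t ^+ 2 - (t ^+ 2)^-1 - 1) = t.
Proof.
move=> t0; have tN0 := lt0r_neq0 t0; have t2 : 0 < t ^+ 2 by rewrite exprn_gt0.
rewrite /stretch_ratio.
have -> : (1 + (2 * t ^+ 2 - (t ^+ 2)^-1 - 1)) ^+ 2 + 8 =
    (2 * t ^+ 2 + (t ^+ 2)^-1) ^+ 2.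
  by field.
rewrite sqrtr_sqr ger0_norm; last by rewrite addr_ge0 ?mulr_ge0 ?invr_ge0 ?ltW.
have -> : (1 + (2 * t ^+ 2 - (t ^+ 2)^-1 - 1) + (2 * t ^+ 2 + (t ^+ 2)^-1)) / 4 =
    t ^+ 2.
  by field.
by rewrite sqrtr_sqr gtr0_norm.
Qed.

(** Passing to the logarithm makes the extension of the profile automatically
    positive, whatever the values of [E] and [O] are. *)
Lemma log_profile_decomposition k (f : R -> R) :
  (forall x : R, 0 < x -> 0 < f x) -> smooth_pos f -> (f^`())%classic 1 = 0 ->
  exists E O : R -> R, [/\ is_Ck setT k E, is_Ck setT k O &
    forall t, 0 < t -> let z := 2 * t ^+ 2 - (t ^+ 2)^-1 - 1 in
      f t = expR (E (z ^+ 2) + z ^+ 3 * O (z ^+ 2))].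
Proof.
move=> f0 fs f'1; pose g := @ln R \o (f \o stretch_ratio).
have fsr x : 0 < f (stretch_ratio x) by apply/f0/stretch_ratio_gt0.
have gC n : is_Ck setT n g.
  apply: is_Ck_comp (is_Ck_ln n) _ => [x _|]; first exact: fsr.
  apply: is_Ck_comp (is_Ck_smooth_pos n fs) (is_Ck_stretch_ratio n) => x _.
  exact: stretch_ratio_gt0.
have sr0 : stretch_ratio 0 = 1.
  rewrite -[RHS](stretch_ratioE ltr01); congr stretch_ratio.
  by rewrite expr1n invr1; ring.
have g'0 : is_derive (0 : R) 1 g 0.
  have [s' ds _] := is_Ck_ex_derive (is_Ck_stretch_ratio 1).
  have ds0 := ds 0 I.
  have df : is_derive (stretch_ratio 0) 1 f 0.
    by rewrite sr0; split; [exact: (fs 0%N)|rewrite -derive1E].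
  have dln := is_derive1_ln (fsr 0).
  have dfs := is_derive1_comp df ds0.
  by apply: is_derive_eq (is_derive1_comp dln dfs) _; rewrite mul0r mulr0.
have [Ev [Od [EC OC gE]]] := even_odd_decomposition (gC (2 * k + 4)%N) g'0.
exists Ev, Od; split=> // t t0 z; rewrite -gE /g /= stretch_ratioE // lnK // posrE.
exact: f0.
Qed.

End EvenOdd.

(** * Invariants of the Cauchy-Green matrix *)

Section Invariants.
Context {R : realType}.
Implicit Types (X F U : 'M[R]_3) (w : 'cV[R]_3).

Definition gram F : 'M[R]_3 := F^T *m F.
Definition deviator X : 'M[R]_3 := X - (\tr X / 3)%:M.

(** The trace of [X^-1]: the second elementary symmetric function of the
    eigenvalues over the third. *)
Definition trace_inv X : R := ((\tr X) ^+ 2 - \tr (X *m X)) / 2 / \det X.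

(** For [X] with eigenvalues [A], [B], [B], the deviator has eigenvalues
    [2 (A - B) / 3], [- (A - B) / 3], [- (A - B) / 3], so that the next two
    invariants are the square and the cube of [(A - B) * trace_inv X].  The factor
    [trace_inv X] makes the invariants homogeneous of degree 0. *)
Definition even_invariant X : R :=
  3 / 2 * \tr (deviator X *m deviator X) * trace_inv X ^+ 2.

Definition odd_invariant X : R :=
  27 / 2 * \det (deviator X) * trace_inv X ^+ 3.

Section Invariance.
Variables (U X : 'M[R]_3).
Hypothesis (UU : U *m U^T = 1%:M).

Lemma mxtrace_orthogonal_conj : \tr (U^T *m X *m U) = \tr X.
Proof. by rewrite -mulmxA mxtrace_mulC -mulmxA UU mulmx1. Qed.

Lemma det_orthogonal_conj : \det (U^T *m X *m U) = \det X.
Proof. by rewrite !det_mulmx mulrAC -det_mulmx (mulmx1C UU) det1 mul1r. Qed.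

Lemma sqr_orthogonal_conj :
  (U^T *m X *m U) *m (U^T *m X *m U) = U^T *m (X *m X) *m U.
Proof. by rewrite !mulmxA -[_ *m U *m U^T]mulmxA UU mulmx1. Qed.

End Invariance.

Lemma trace_inv_conj U X : U *m U^T = 1%:M ->
  trace_inv (U^T *m X *m U) = trace_inv X.
Proof.
move=> UU; rewrite /trace_inv sqr_orthogonal_conj //.
by rewrite !mxtrace_orthogonal_conj // det_orthogonal_conj.
Qed.

Lemma deviator_conj U X : U *m U^T = 1%:M ->
  deviator (U^T *m X *m U) = U^T *m deviator X *m U.
Proof.
move=> UU; rewrite /deviator mxtrace_orthogonal_conj // mulmxBr mulmxBl.
by rewrite mul_mx_scalar -scalemxAl (mulmx1C UU) scalemx1.
Qed.

Lemma even_invariant_conj U X : U *m U^T = 1%:M ->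
  even_invariant (U^T *m X *m U) = even_invariant X.
Proof.
move=> UU; rewrite /even_invariant trace_inv_conj // deviator_conj //.
by rewrite sqr_orthogonal_conj // mxtrace_orthogonal_conj.
Qed.

Lemma odd_invariant_conj U X : U *m U^T = 1%:M ->
  odd_invariant (U^T *m X *m U) = odd_invariant X.
Proof.
move=> UU; rewrite /odd_invariant trace_inv_conj // deviator_conj //.
by rewrite det_orthogonal_conj.
Qed.

Lemma deviatorZ c X : deviator (c *: X) = c *: deviator X.
Proof. by rewrite /deviator mxtraceZ scalerBr scale_scalar_mx mulrA. Qed.

Lemma trace_invZ c X : c != 0 -> trace_inv (c *: X) = c^-1 * trace_inv X.
Proof.
move=> c0; rewrite /trace_inv -scalemxAl -scalemxAr !mxtraceZ detZ.
by rewrite invfM; move: (\det X)^-1 => d; field.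
Qed.

Lemma even_invariantZ c X : c != 0 -> even_invariant (c *: X) = even_invariant X.
Proof.
move=> c0; rewrite /even_invariant deviatorZ trace_invZ // -scalemxAl -scalemxAr.
by rewrite !mxtraceZ; field.
Qed.

Lemma odd_invariantZ c X : c != 0 -> odd_invariant (c *: X) = odd_invariant X.
Proof.
by move=> c0; rewrite /odd_invariant deviatorZ trace_invZ // detZ; field.
Qed.

Section Axisymmetric.
Variables (w : 'cV[R]_3).
Hypothesis (w1 : sphere w).

Lemma sphere_tr_mul : w^T *m w = 1%:M.
Proof.
apply/matrixP => i j; rewrite !ord1 !mxE eqxx -[RHS]w1.
by apply: eq_bigr => k _; rewrite mxE -expr2.
Qed.

(** For [w] on the sphere, [P1 w] and [P2 w] are complementary projections, so
    these matrices multiply like their pairs of coefficients. *)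
Lemma FstrainM a b c d :
  Fstrain a b w *m Fstrain c d w = Fstrain (a * c) (b * d) w.
Proof.
have PP : P1 w *m P1 w = P1 w.
  by rewrite /P1 mulmxA -[w *m w^T *m w]mulmxA sphere_tr_mul mulmx1.
have QE : P2 w = 1%:M - P1 w by [].
rewrite /Fstrain QE !mulmxDl !mulmxDr -!scalemxAl -!scalemxAr !scalerA.
by rewrite !mulmxBl !mulmxBr !mulmx1 !mul1mx PP !subrr !scaler0 subr0 addr0 add0r.
Qed.

Lemma tr_Fstrain a b : (Fstrain a b w)^T = Fstrain a b w.
Proof.
by rewrite /Fstrain /P1 /P2 linearD !linearZ /= linearB /= trmx1 trmx_mul trmxK.
Qed.

Lemma mxtrace_Fstrain a b : \tr (Fstrain a b w) = a + 2 * b.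
Proof.
have trP : \tr (w *m w^T) = 1 by rewrite mxtrace_mulC sphere_tr_mul mxtrace1.
rewrite /Fstrain /P1 /P2 mxtraceD !mxtraceZ [\tr (_ - _)]linearB /= mxtrace1 trP.
ring.
Qed.

Lemma scalar_mx_Fstrain c : c%:M = Fstrain c c w.
Proof. by rewrite /Fstrain /P1 /P2 -scalerDr addrC subrK scalemx1. Qed.

Lemma det_Fstrain a b : \det (Fstrain a b w) = a * b ^+ 2.
Proof.
(* Indexing by nat lets the indices produced by cofactors compute. *)
pose v (n : nat) := w (inord n) 0.
have v1 : v 0%N ^+ 2 + (v 1%N ^+ 2 + v 2%N ^+ 2) = 1.
  rewrite -w1 !big_ord_recl big_ord0 addr0 /v.
  by do ![congr (_ + _)]; congr (w _ _ ^+ 2); apply/val_inj; rewrite /= inordK.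
have FE i j : Fstrain a b w i j = (a - b) * (v i * v j) + b * (i == j :> nat)%:R.
  by rewrite !mxE !big_ord1 !mxE /v !inord_val; ring.
move: (Fstrain a b w) FE => A FE.
rewrite (expand_det_row _ 0) !big_ord_recl big_ord0 /cofactor.
rewrite !(expand_det_row _ 0) !big_ord_recl !big_ord0 /cofactor !det_mx11.
rewrite !mxE !FE /= /bump /=.
transitivity (b ^+ 3 +
    b ^+ 2 * (a - b) * (v 0%N ^+ 2 + (v 1%N ^+ 2 + v 2%N ^+ 2))); first by ring.
by rewrite v1; ring.
Qed.

Lemma deviator_Fstrain a b : deviator (Fstrain a b w) =
  Fstrain (2 / 3 * (a - b)) (- (a - b) / 3) w.
Proof.
rewrite /deviator (scalar_mx_Fstrain (\tr _ / 3)) mxtrace_Fstrain.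
rewrite /Fstrain opprD addrACA -!scalerBl; by congr (_ *: _ + _ *: _); field.
Qed.

Lemma gram_Fstrain a b : gram (Fstrain a b w) = Fstrain (a ^+ 2) (b ^+ 2) w.
Proof. by rewrite /gram tr_Fstrain FstrainM. Qed.

Variables (a b : R).
Hypotheses (a0 : 0 < a) (b0 : 0 < b).
Let z : R := 2 * (a / b) ^+ 2 - ((a / b) ^+ 2)^-1 - 1.

Lemma even_invariant_Fstrain : even_invariant (gram (Fstrain a b w)) = z ^+ 2.
Proof.
rewrite gram_Fstrain /even_invariant deviator_Fstrain /trace_inv !FstrainM.
rewrite !mxtrace_Fstrain det_Fstrain /z; field.
by rewrite !lt0r_neq0.
Qed.

Lemma odd_invariant_Fstrain : odd_invariant (gram (Fstrain a b w)) = z ^+ 3.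
Proof.
rewrite gram_Fstrain /odd_invariant deviator_Fstrain /trace_inv !FstrainM.
rewrite !mxtrace_Fstrain !det_Fstrain /z; field.
by rewrite !lt0r_neq0.
Qed.

End Axisymmetric.

Lemma det_gram (F : 'M[R]_3) : \det (gram F) = \det F ^+ 2.
Proof. by rewrite det_mulmx det_tr. Qed.

Lemma gramMl (U F : 'M[R]_3) : U *m U^T = 1%:M -> gram (U *m F) = gram F.
Proof.
by move=> UU; rewrite /gram trmx_mul mulmxA -[_ *m U]mulmxA (mulmx1C UU) mulmx1.
Qed.

Lemma gramMr (U F : 'M[R]_3) : gram (F *m U) = U^T *m gram F *m U.
Proof. by rewrite /gram trmx_mul !mulmxA. Qed.

Lemma gramZ (s : R) (F : 'M[R]_3) : gram (s *: F) = (s ^+ 2) *: gram F.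
Proof. by rewrite /gram [(s *: F)^T]linearZ /= -scalemxAl -scalemxAr scalerA. Qed.

End Invariants.

(** * Smoothness of the invariants *)

Section SmoothInvariants.
Context {R : realType}.

Definition is_Ck_mx (D : set 'M[R]_3) k (M : 'M[R]_3 -> 'M[R]_3) :=
  forall i j, is_Ck D k (fun F => M F i j).

Lemma is_Ck_mxtrace D k M : is_Ck_mx D k M -> is_Ck D k (fun F => \tr (M F)).
Proof. by move=> MC; apply: is_Ck_sum => i; exact: MC. Qed.

Lemma is_Ck_det D k M : is_Ck_mx D k M -> is_Ck D k (fun F => \det (M F)).
Proof.
move=> MC; apply: is_Ck_sum => s; apply: is_CkM; first exact: is_Ck_cst.
by apply: is_Ck_prod => i; exact: MC.
Qed.

Lemma is_Ck_mulmx D k M N : is_Ck_mx D k M -> is_Ck_mx D k N ->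
  is_Ck_mx D k (fun F => M F *m N F).
Proof.
move=> MC NC i j.
rewrite (_ : (fun F => _) = fun F => \sum_l M F i l * N F l j).
  by apply: is_Ck_sum => l; exact: (is_CkM (MC _ _) (NC _ _)).
by apply/funext => F; rewrite mxE.
Qed.

Lemma is_Ck_gram D k : is_Ck_mx D k gram.
Proof.
apply: is_Ck_mulmx => i j; last exact: is_Ck_coord.
rewrite (_ : (fun F => _) = fun F : 'M[R]_3 => F j i); first exact: is_Ck_coord.
by apply/funext => F; rewrite mxE.
Qed.

Lemma is_Ck_deviator D k M : is_Ck_mx D k M ->
  is_Ck_mx D k (fun F => deviator (M F)).
Proof.
move=> MC i j.
rewrite (_ : (fun F => _) = fun F : 'M[R]_3 =>
    M F i j + (- (3^-1 *+ (i == j))) * \tr (M F)).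
  apply: is_CkD (MC i j) _; apply: is_CkZ; exact: is_Ck_mxtrace.
by apply/funext => F; rewrite !mxE; case: (i == j); rewrite ?mulr1n ?mulr0n; ring.
Qed.

Lemma is_Ck_trace_inv D k M : (forall F, D F -> \det (M F) != 0) ->
  is_Ck_mx D k M -> is_Ck D k (fun F => trace_inv (M F)).
Proof.
move=> M0 MC; have tC := is_Ck_mxtrace MC.
apply: is_CkM; last by apply: is_CkV M0 _; exact: is_Ck_det.
apply: is_CkM _ (is_Ck_cst _ _ _).
rewrite (_ : (fun F => _) = fun F =>
    \tr (M F) * \tr (M F) + -1 * \tr (M F *m M F)).
  apply: is_CkD; first exact: (is_CkM tC tC).
  by apply: is_CkZ; apply: is_Ck_mxtrace; exact: is_Ck_mulmx.
by apply/funext => F; rewrite expr2 mulN1r.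
Qed.

Lemma is_Ck_even_invariant D k (M : 'M[R]_3 -> 'M[R]_3) :
  (forall F, D F -> \det (M F) != 0) ->
  is_Ck_mx D k M -> is_Ck D k (fun F => even_invariant (M F)).
Proof.
move=> M0 MC; have tC := is_Ck_trace_inv M0 MC; have dC := is_Ck_deviator MC.
rewrite (_ : (fun F => _) = fun F =>
    (3 / 2 * \tr (deviator (M F) *m deviator (M F))) *
    (trace_inv (M F) * trace_inv (M F))); last first.
  by apply/funext => F; rewrite /even_invariant expr2.
apply: is_CkM; last exact: (is_CkM tC tC).
by apply: is_CkZ; apply: is_Ck_mxtrace; exact: is_Ck_mulmx.
Qed.

Lemma is_Ck_odd_invariant D k (M : 'M[R]_3 -> 'M[R]_3) :
  (forall F, D F -> \det (M F) != 0) ->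
  is_Ck_mx D k M -> is_Ck D k (fun F => odd_invariant (M F)).
Proof.
move=> M0 MC; have tC := is_Ck_trace_inv M0 MC; have dC := is_Ck_deviator MC.
rewrite (_ : (fun F => _) = fun F => (27 / 2 * \det (deviator (M F))) *
    (trace_inv (M F) * (trace_inv (M F) * trace_inv (M F)))); last first.
  by apply/funext => F; rewrite /odd_invariant !exprS expr0 mulr1.
apply: is_CkM; last exact: (is_CkM tC (is_CkM tC tC)).
by apply: is_CkZ; exact: is_Ck_det.
Qed.

Lemma open_GLplus : open (@GLplus R 3).
Proof.
have detC : continuous (fun F : 'M[R]_3 => \det F).
  by move=> F; apply: (@is_Ck_det setT 0 id) => // i j; exact: is_Ck_coord.
have -> : @GLplus R 3 = (fun F : 'M[R]_3 => \det F) @^-1` [set x | 0 < x] by [].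
by apply: open_comp => [F _|]; [exact: detC|exact: open_gt].
Qed.

End SmoothInvariants.

(** * The energy *)

Section Energy.
Context {R : realType}.

(** The factor [det F ^ (h / 3)] carries the homogeneity, the exponential is
    invariant under dilations. *)
Definition energy (h : R) (E O : R -> R) (F : 'M[R]_3) : R :=
  \det F `^ (h / 3) * expR (E (even_invariant (gram F)) +
    odd_invariant (gram F) * O (even_invariant (gram F))).

Variables (h : R) (E O : R -> R).
Let W := energy h E O.

Lemma energy_class_C : is_Ck setT 2 E -> is_Ck setT 2 O ->
  class_C (@GLplus R 3) 2 W.
Proof.
move=> EC OC; apply: is_Ck_class_C; first exact: open_GLplus.
have g0 (F : 'M[R]_3) : GLplus F -> \det (gram F) != 0.
  by rewrite det_gram => F0; rewrite expf_neq0 // lt0r_neq0.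
have gC := is_Ck_gram (@GLplus R 3) 2.
have uC := is_Ck_even_invariant g0 gC.
have wC := is_Ck_odd_invariant g0 gC.
apply: is_CkM.
  apply: is_Ck_powR => //; first exact: open_GLplus.
  by apply: (@is_Ck_det _ _ _ id) => i j; exact: is_Ck_coord.
apply: (@is_Ck_comp _ _ _ setT) => //; first exact: is_Ck_expR.
apply: is_CkD; first exact: (@is_Ck_comp _ _ _ setT).
apply: is_CkM wC _; exact: (@is_Ck_comp _ _ _ setT).
Qed.

Lemma energy_objective : objective W.
Proof.
by move=> F U _ [UU U1]; rewrite /W /energy gramMl // det_mulmx U1 mul1r.
Qed.

Lemma energy_isotropic : isotropic W.
Proof.
move=> F U _ [UU U1]; rewrite /W /energy gramMr det_mulmx U1 mulr1.
by rewrite even_invariant_conj // odd_invariant_conj.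
Qed.

Lemma energy_homogeneous : homogeneous h W.
Proof.
move=> F s F0 s0; have s20 : s ^+ 2 != 0 by rewrite expf_neq0 // lt0r_neq0.
rewrite /W /energy gramZ even_invariantZ // odd_invariantZ // detZ.
rewrite powRM ?exprn_ge0 ?ltW // -powR_mulrn ?ltW // -powRrM.
by rewrite [3%:R * _]mulrC divfK // mulrA.
Qed.

Lemma energy_Fstrain (l1 l2 : R) (w : 'cV[R]_3) :
  0 < l1 -> 0 < l2 -> sphere w ->
  let z := 2 * (l1 / l2) ^+ 2 - ((l1 / l2) ^+ 2)^-1 - 1 in
  W (Fstrain l1 l2 w) =
    (l1 * l2 ^+ 2) `^ (h / 3) * expR (E (z ^+ 2) + z ^+ 3 * O (z ^+ 2)).
Proof.
move=> l10 l20 w1 z.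
rewrite /W /energy even_invariant_Fstrain // odd_invariant_Fstrain //.
by rewrite det_Fstrain.
Qed.

End Energy.

Theorem theorem11p1 (R : realType) (h : R) (f : R -> R)
    (f_pos : forall x : R, 0 < x -> 0 < f x)
    (f_smooth : smooth_pos f)
    (f'1 : (f^`())%classic 1 = 0) :
  exists W : 'M[R]_3 -> R,
    (forall F : 'M[R]_3, GLplus F -> 0 <= W F) /\
    class_C (@GLplus R 3) 2 W /\
    objective W /\
    isotropic W /\
    homogeneous h W /\
    (forall (l1 l2 : R) (w : 'cV[R]_3), 0 < l1 -> 0 < l2 -> @sphere R 3 w ->
       W (Fstrain l1 l2 w) = (l1 * l2 ^+ 2) `^ (h / 3%:R) * f (l1 / l2)).
Proof.
have [A [B [AC BC fE]]] := log_profile_decomposition 2 f_pos f_smooth f'1.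
exists (energy h A B); split.
  by move=> F _; rewrite mulr_ge0 ?powR_ge0 ?expR_ge0.
split; first exact: energy_class_C.
split; first exact: energy_objective.
split; first exact: energy_isotropic.
split; first exact: energy_homogeneous.
move=> l1 l2 w l10 l20 w1; rewrite energy_Fstrain //.
by rewrite -fE // divr_gt0.
Qed.
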